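(* For $\mu\in(0,1)$ consider the Markov chain $(\sigma_j)_{j\ge 0}$ on $\{0,1\}$ with $\sigma_0=0$ and $P(0\to1)=P(1\to0)=(1-\mu)/2$, let $\nu_L=\sum_{j=1}^L\sigma_j$ and $D(L,\mu)=\mathrm{Var}(\nu_L)/\mathrm{E}[\nu_L]$. Then: (a) for each fixed $\mu\in(0,1)$, $D(L,\mu)$ is strictly increasing in $L$; (b) for each fixed $L\ge1$, $D(L,\mu)$ is strictly increasing in $\mu$; (c) letting $\mu^*(L)$ denote the unique solution $\mu\in(0,1)$ of $D(L,\mu)=1$, the sequence $\mu^*(L)$ is strictly decreasing in $L$ and $\mu^*(L)=\tfrac13+\tfrac{1}{6L}+O(1/L^2)$ as $L\to\infty$.
   Context: This is the state chain of a symmetric stateful digit-wise operation ($|\mathrm{GEN}|=|\mathrm{KILL}|$, $\mu=|\mathrm{PROP}|/N$) with uniformly random symbols, started at state $0$; $\mu$ is treated as a real parameter.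
   Formalization: In (c), μ*(L) is taken only for L ≥ 2: for L = 1, D(1,μ) = (1+μ)/2 < 1 on (0,1), so D(1,μ) = 1 has no solution and μ*(1) does not exist; existence and uniqueness are asserted for every L ≥ 2. *)

(* Defs.v *)
From HB Require Import structures.
From mathcomp Require Export all_boot all_order all_algebra.
From mathcomp Require Export all_classical all_reals all_analysis.
Export Order.TTheory GRing.Theory Num.Theory.
Export numFieldNormedType.Exports.

Set Implicit Arguments.
Unset Strict Implicit.
Unset Printing Implicit Defensive.

Local Open Scope classical_set_scope.
Local Open Scope ring_scope.

(* Homogeneous Markov chain started at s0 on a discrete state space S.  The
   equation P(X_{n+1} = s_{n+1} | X_0 = s_0, ..., X_n = s_n) = p(s_n, s_{n+1})
   is multiplied out by the probability of the conditioning event, so that it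
   is vacuous (0 = 0) on histories of probability zero. *)
Definition markov_chain (d d' : measure_display) (T : measurableType d)
    (S : measurableType d') (R : realType) (P : probability T R)
    (p : S -> S -> R) (s0 : S) (X : nat -> {RV P >-> S}) : Prop :=
  P [set w | X 0%N w = s0] = 1%E /\
  forall (n : nat) (s : nat -> S),
    P [set w | forall i, (i <= n.+1)%N -> X i w = s i] =
    (P [set w | forall i, (i <= n)%N -> X i w = s i] * (p (s n) (s n.+1))%:E)%E.

(* The states 0 and 1 are [false] and [true]. *)
Definition state_kernel (R : realType) (mu : R) (a b : bool) : R :=
  if a == b then (1 + mu) / 2 else (1 - mu) / 2.

Definition state_count (d : measure_display) (T : measurableType d)
    (R : realType) (P : probability T R) (sigma : nat -> {RV P >-> bool})
    (L : nat) : T -> R :=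
  fun w => \sum_(1 <= j < L.+1) (sigma j w)%:R.

Definition dispersion (d : measure_display) (T : measurableType d)
    (R : realType) (P : probability T R) (sigma : nat -> {RV P >-> bool})
    (L : nat) : R :=
  fine ('V_P[state_count sigma L])%E / fine ('E_P[state_count sigma L])%E.

(* Main.v *)
Require Import Defs.
From mathcomp Require Import ring lra.

(** Put b_n = 1 + mu + ... + mu^(n-1).  The chain has P(sigma_j = 1) =
    (1 - mu) b_j / 2 and P(sigma_i = sigma_j = 1) =
    P(sigma_i = 1) (1 + mu^(j-i)) / 2 for i <= j, and summing the covariances
    gives D(L, mu) = (1 + mu)/2 * (sum_j b_j^2) / (sum_j b_j).  The quotient is
    the mean of the b_j with weights b_j.  It grows with L because b_j does.  It
    grows with mu because the b_j do and, b_j(mu')/b_j(mu) being nondecreasing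
    in j for mu < mu', raising mu shifts the weights towards larger b_j.
    Finally D(L, mu) = 1 is equivalent to
    L (3 mu - 1) (1 - mu) = mu^2 (1 - mu^L) (3 - mu^L), and its solutions stay
    below 3/5, which gives the expansion. *)

Local Open Scope classical_set_scope.
Local Open Scope ring_scope.

(** * The q-numbers [b_n] and the monotonicity of the closed form of D *)

Definition qnum {R : pzRingType} (x : R) (n : nat) : R := \sum_(i < n) x ^+ i.

Definition qnum_sum {R : pzRingType} (x : R) (L : nat) : R :=
  \sum_(1 <= j < L.+1) qnum x j.

Definition qnum_sqsum {R : pzRingType} (x : R) (L : nat) : R :=
  \sum_(1 <= j < L.+1) qnum x j ^+ 2.

(** The closed form of D(L, x); [dispersion_qdisp] identifies it with the dispersion of the
    chain. *)
Definition qdisp {R : realFieldType} (L : nat) (x : R) : R :=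
  (1 + x) / 2 * (qnum_sqsum x L / qnum_sum x L).

Section QNumbers.
Context {R : realFieldType}.
Implicit Types (x y : R) (m n L : nat).

Lemma qnumS x n : qnum x n.+1 = qnum x n + x ^+ n.
Proof. by rewrite /qnum big_ord_recr. Qed.

Lemma qnum_mul1B x n : qnum x n * (1 - x) = 1 - x ^+ n.
Proof. by rewrite mulrC -opprB mulNr -subrX1 opprB. Qed.

Lemma qnum_sumS x L : qnum_sum x L.+1 = qnum_sum x L + qnum x L.+1.
Proof. by rewrite /qnum_sum big_nat_recr. Qed.

Lemma qnum_sqsumS x L : qnum_sqsum x L.+1 = qnum_sqsum x L + qnum x L.+1 ^+ 2.
Proof. by rewrite /qnum_sqsum big_nat_recr. Qed.

Lemma qnum_ge0 x n : 0 <= x -> 0 <= qnum x n.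
Proof. by move=> x0; apply: sumr_ge0 => i _; exact: exprn_ge0. Qed.

Lemma qnum_gt0 x n : 0 <= x -> 0 < qnum x n.+1.
Proof.
move=> x0; rewrite /qnum big_ord_recl expr0 ltr_pwDl//.
by apply: sumr_ge0 => i _; exact: exprn_ge0.
Qed.

Lemma qnum_ltn x : 0 < x -> {homo qnum x : m n / (m < n)%N >-> m < n}.
Proof.
move=> x0; apply: homo_ltn => [? ? ?|n]; first exact: lt_trans.
by rewrite qnumS ltrDl exprn_gt0.
Qed.

Lemma qnum_le x y n : 0 <= x -> x <= y -> qnum x n <= qnum y n.
Proof.
move=> x0 xy; apply: ler_sum => i _.
by rewrite lerXn2r ?nnegrE// (le_trans x0).
Qed.

Lemma qnum_sum_gt0 x L : 0 <= x -> (0 < L)%N -> 0 < qnum_sum x L.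
Proof.
case: L => // L x0 _; rewrite qnum_sumS ltr_wpDl ?qnum_gt0//.
by apply: sumr_ge0 => i _; exact: qnum_ge0.
Qed.

(* In other words, [qnum y n / qnum x n] is nondecreasing in [n]. *)
Lemma qnum_ratio_le x y m n : 0 < x -> x <= y -> (m <= n)%N ->
  qnum y m * qnum x n <= qnum y n * qnum x m.
Proof.
move=> x0 xy /subnK <-; elim: (n - m)%N => // k IH.
have y0 : 0 < y by exact: lt_le_trans xy.
rewrite addSn !qnumS mulrDr mulrDl lerD//.
rewrite /qnum mulr_suml mulr_sumr; apply: ler_sum => i _.
(* Up to the common factor [x^i y^i] the claim is [x^d <= y^d] with [d = k + m - i]. *)
have /subnK <- : (i <= k + m)%N.
  by rewrite (leq_trans (ltnW (ltn_ord i)))// leq_addl.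
set d := (_ - i)%N; rewrite !exprD.
have -> : y ^+ i * (x ^+ d * x ^+ i) = x ^+ d * (y ^+ i * x ^+ i) by ring.
have -> : y ^+ d * y ^+ i * x ^+ i = y ^+ d * (y ^+ i * x ^+ i) by ring.
by rewrite ler_wpM2r ?mulr_ge0 ?exprn_ge0 ?lerXn2r ?nnegrE// ltW.
Qed.

(* Chebyshev's sum inequality: passing from the weights [qnum x] to the weights
   [qnum y] increases the mean of the increasing sequence [qnum x]. *)
Lemma qnum_mean_reweight x y L : 0 < x -> x <= y ->
  qnum_sqsum x L * qnum_sum y L <=
  (\sum_(1 <= j < L.+1) qnum x j * qnum y j) * qnum_sum x L.
Proof.
move=> x0 xy; rewrite -subr_ge0.
pose f m n := qnum x m * (qnum y m * qnum x n - qnum x m * qnum y n).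
have E : (\sum_(1 <= j < L.+1) qnum x j * qnum y j) * qnum_sum x L -
    qnum_sqsum x L * qnum_sum y L =
    \sum_(1 <= m < L.+1) \sum_(1 <= n < L.+1) f m n.
  rewrite /qnum_sqsum !mulr_suml -sumrB; apply: eq_bigr => m _.
  rewrite /qnum_sum [X in X - _]mulr_sumr [X in _ - X]mulr_sumr -sumrB.
  by apply: eq_bigr => n _; rewrite /f; ring.
(* Twice the double sum is the sum of the [f m n + f n m], each a product of two factors that never
   have opposite signs. *)
rewrite E -(pmulrn_lge0 _ (isT : (0 < 2)%N)) mulr2n {2}exchange_big -big_split.
apply: sumr_ge0 => m _; rewrite -big_split; apply: sumr_ge0 => n _ /=.
rewrite [leRHS](_ : _ = (qnum x m - qnum x n) *
  (qnum y m * qnum x n - qnum y n * qnum x m)); last by rewrite /f; ring.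
have mono := ltW_homo (qnum_ltn _ x0).
have [mn|/ltnW nm] := leqP m n.
  by rewrite mulr_le0// subr_le0 ?qnum_ratio_le// mono.
by rewrite mulr_ge0// subr_ge0 ?qnum_ratio_le ?mono.
Qed.

(** Passing from L to L + 1 brings into the weighted mean the value [b_(L+1)], which exceeds all
    earlier ones. *)
Lemma qdisp_ltn x : 0 < x -> {in [pred L | (1 <= L)%N] &,
  {homo qdisp^~ x : L L' / (L < L')%N >-> L < L'}}.
Proof.
move=> x0; apply: homo_ltn_in => [? ? ?|m n m0 _ k /andP[mk _]|L L0 _].
- exact: lt_trans.
- exact: leq_trans mk.
rewrite !inE in L0 *; rewrite /qdisp ltr_pM2l ?divr_gt0 ?addr_gt0//.
have B0 := qnum_sum_gt0 _ L (ltW x0) L0; have b0 := qnum_gt0 _ L (ltW x0).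
rewrite qnum_sqsumS qnum_sumS ltr_pdivrMr// mulrAC ltr_pdivlMr ?addr_gt0//.
rewrite mulrDr mulrDl ltrD2l expr2 mulrC -mulrA ltr_pM2l//.
rewrite /qnum_sqsum /qnum_sum mulr_sumr.
apply: ltr_sum_nat => // -[//|i] /andP[_ iL].
by rewrite expr2 ltr_pM2r ?qnum_gt0 ?(ltW x0)// qnum_ltn.
Qed.

(** Reweighting and then raising the values gives only a weak inequality of means, since for L = 1
    the mean is constantly 1; strictness comes from the factor [(1 + x) / 2]. *)
Lemma qdisp_lt L x y : (1 <= L)%N -> 0 < x -> x < y -> qdisp L x < qdisp L y.
Proof.
move=> L0 x0 xy; have y0 : 0 < y by exact: lt_trans xy.
have Bx := qnum_sum_gt0 _ L (ltW x0) L0.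
have By := qnum_sum_gt0 _ L (ltW y0) L0.
have Q0 : 0 < qnum_sqsum x L.
  case: {Bx By} L L0 => // L _.
  rewrite qnum_sqsumS ltr_wpDl ?exprn_gt0 ?qnum_gt0 ?(ltW x0)//.
  by apply: sumr_ge0 => i _; exact: sqr_ge0.
have le : qnum_sqsum x L / qnum_sum x L <= qnum_sqsum y L / qnum_sum y L.
  rewrite ler_pdivrMr// mulrAC ler_pdivlMr//.
  apply: le_trans (qnum_mean_reweight _ _ L x0 (ltW xy)) _.
  rewrite ler_pM2r//; apply: ler_sum => j _.
  by rewrite expr2 ler_wpM2r ?qnum_ge0 ?qnum_le ?ltW.
apply: (@lt_le_trans _ _ ((1 + y) / 2 * (qnum_sqsum x L / qnum_sum x L))).
  by rewrite ltr_pM2r ?divr_gt0//; lra.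
by rewrite ler_pM2l//; lra.
Qed.

(** * Closed forms and the equation D = 1 *)

(** Leaving [b_L] unexpanded allows [sum_covariance_state] to eliminate L in favour of q-numbers. *)
Lemma qnum_sum_mul1B_rec x L : qnum_sum x L * (1 - x) = L%:R - x * qnum x L.
Proof.
elim: L => [|L IH]; first by rewrite /qnum_sum /qnum big_geq// big_ord0; ring.
rewrite qnum_sumS mulrDl IH qnum_mul1B -[L.+1%:R]natr1 exprS qnumS.
by ring.
Qed.

Lemma qnum_sum_mul1B x L :
  qnum_sum x L * (1 - x) ^+ 2 = L%:R * (1 - x) - x * (1 - x ^+ L).
Proof.
by rewrite expr2 mulrA qnum_sum_mul1B_rec mulrBl -(mulrA x) qnum_mul1B.
Qed.

(** Two factors [1 - x] turn [b_j^2] into [(1 - x^j)^2]; the remaining [(1 + x)(1 - x)] clears the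
    denominators of the geometric series in [x] and [x^2]. *)
Lemma qnum_sqsum_mul1B x L : (1 + x) * qnum_sqsum x L * (1 - x) ^+ 3 =
  L%:R * (1 - x ^+ 2) - 2 * x * (1 + x) * (1 - x ^+ L)
  + x ^+ 2 * (1 - (x ^+ L) ^+ 2).
Proof.
elim: L => [|L IH]; first by rewrite /qnum_sqsum big_geq//; ring.
rewrite qnum_sqsumS mulrDr mulrDl IH.
have -> : (1 + x) * qnum x L.+1 ^+ 2 * (1 - x) ^+ 3 =
  (1 + x) * (1 - x) * (qnum x L.+1 * (1 - x)) ^+ 2 by ring.
by rewrite qnum_mul1B -[L.+1%:R]natr1 [x ^+ L.+1]exprS; ring.
Qed.

Lemma qdisp_eq1 L x : (1 <= L)%N -> 0 <= x ->
  qdisp L x = 1 <-> (1 + x) * qnum_sqsum x L = 2 * qnum_sum x L.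
Proof.
move=> L0 x0; have B0 := lt0r_neq0 (qnum_sum_gt0 _ L x0 L0).
rewrite /qdisp; split => [/(congr1 ( *%R^~ (2 * qnum_sum x L)))|E].
  by rewrite mul1r => <-; field.
have -> : (1 + x) / 2 * (qnum_sqsum x L / qnum_sum x L) =
  (1 + x) * qnum_sqsum x L / (2 * qnum_sum x L) by field.
by rewrite E divff// mulf_neq0.
Qed.

Lemma qdisp_eq1_closed L x : (1 <= L)%N -> 0 <= x -> qdisp L x = 1 ->
  L%:R * (3 * x - 1) * (1 - x) = x ^+ 2 * (1 - x ^+ L) * (3 - x ^+ L).
Proof.
move=> L0 x0 /qdisp_eq1 -/(_ L0 x0)/(congr1 ( *%R^~ ((1 - x) ^+ 3))).
rewrite qnum_sqsum_mul1B.
have -> : 2 * qnum_sum x L * (1 - x) ^+ 3 =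
  2 * (1 - x) * (qnum_sum x L * (1 - x) ^+ 2) by ring.
rewrite qnum_sum_mul1B => E; apply/eqP; rewrite -subr_eq0; apply/eqP.
move/eqP : E; rewrite -subr_eq0 => /eqP <-; ring.
Qed.

Lemma qdisp_eq1_lt L x : (2 <= L)%N -> 0 < x -> qdisp L x = 1 -> x < 3 / 5.
Proof.
move=> L2 x0 E; rewrite ltNge; apply/negP => x35.
(* By monotonicity in both arguments, [x >= 3/5] would force D to be at least D(2, 3/5) = 356/325 >
   1. *)
have : qdisp 2 (3 / 5 : R) <= qdisp L x.
  apply: (@le_trans _ _ (qdisp L (3 / 5))).
    move: (L2); rewrite leq_eqVlt => /predU1P[<-//|L3].
    by rewrite ltW// qdisp_ltn// ?inE ?(ltnW L2)//; lra.
  move: x35; rewrite le_eqVlt => /predU1P[->//|x35].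
  by rewrite ltW// qdisp_lt ?(ltnW L2)//; lra.
rewrite E (_ : qdisp 2 (3 / 5) = 356 / 325); first by lra.
rewrite /qdisp !qnum_sqsumS !qnum_sumS /qnum_sqsum /qnum_sum !big_geq//.
by rewrite !qnumS /qnum big_ord0; field.
Qed.

(** With [v = L (3 x - 1)] and [z = L (v - 1/2)] the error is [z / (3 L^2)]. The closed equation
    bounds first [v], then [z]; 1/2 is the value of [3 x^2 / (1 - x)] at 1/3. *)
Lemma qdisp_eq1_asymp L x : (2 <= L)%N -> 0 < x -> qdisp L x = 1 ->
  `|x - (1 / 3 + 1 / (6 * L%:R))| <= 6 / L%:R ^+ 2.
Proof.
move=> L2 x0 E; have x35 := qdisp_eq1_lt _ _ L2 x0 E.
have x1 : x < 1 by lra.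
have := qdisp_eq1_closed _ _ (ltnW L2) (ltW x0) E.
have L0 : 0 < L%:R :> R by rewrite ltr0n (ltn_trans _ L2).
have xL0 : 0 <= x ^+ L by exact: exprn_ge0 (ltW x0).
have xL1 : x ^+ L <= 1 by rewrite exprn_ile1// ltW.
(* Each of the L terms of [b_L] is at least [x^L]. *)
have LxL : L%:R * x ^+ L * (1 - x) <= 1.
  apply: (@le_trans _ _ (qnum x L * (1 - x))).
    rewrite ler_wpM2r ?subr_ge0 ?(ltW x1)// /qnum mulr_natl.
    rewrite -[X in _ *+ X]card_ord -sumr_const.
    apply: ler_sum => i _.
    exact: (ler_wiXn2l (ltW x0) (ltW x1) (ltnW (ltn_ord i))).
  by rewrite qnum_mul1B; lra.
move: (L%:R) (x ^+ L) L0 xL0 xL1 LxL => l t l0 t0 t1 lt_le1 closed.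
set v := l * (3 * x - 1) in closed.
have x2 : x ^+ 2 <= 9 / 25 by rewrite expr2; nra.
have x20 : 0 <= x ^+ 2 by exact: sqr_ge0.
have v1x : v * (1 - x) <= 27 / 25.
  rewrite closed.
  have : (1 - t) * (3 - t) <= 3 by nra.
  have : 0 <= (1 - t) * (3 - t) by apply: mulr_ge0; lra.
  rewrite -mulrA; move: (_ * _) => u; nra.
have v0 : 0 <= v.
  rewrite -(pmulr_lge0 _ (_ : 0 < 1 - x)) ?subr_gt0// closed.
  by rewrite !mulr_ge0//; lra.
have v3 : v <= 27 / 10 by nra.
have lt52 : l * t <= 5 / 2 by have := mulr_ge0 (ltW l0) t0; nra.
have lt0 : 0 <= l * t by rewrite mulr_ge0// ltW.
(* Since [6 x^2 + x - 1 = (3 x - 1)(2 x + 1)], the part without [t] carries the bounded factor [v],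
   and the rest carries the bounded factor [l t]. *)
have z1x : l * (v - 1 / 2) * (1 - x) =
    v * (2 * x + 1) / 2 - (l * t) * ((4 - t) * x ^+ 2).
  have -> : l * (v - 1 / 2) * (1 - x) =
    l * (v * (1 - x)) - l * (1 - x) / 2 by field.
  by rewrite closed /v; field.
set z := l * (v - 1 / 2) in z1x.
have w0 : 0 <= (4 - t) * x ^+ 2 by rewrite mulr_ge0//; lra.
have w1 : (4 - t) * x ^+ 2 <= 36 / 25 by nra.
have z_ub : z * (1 - x) <= 3 by nra.
have z_lb : - 4 <= z * (1 - x) by nra.
have z18 : `|z| <= 18 by rewrite ler_norml; apply/andP; split; nra.
have -> : x - (1 / 3 + 1 / (6 * l)) = z / (3 * l ^+ 2).
  by rewrite /z /v; field; exact: lt0r_neq0.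
have l20 : 0 < l ^+ 2 by exact: exprn_gt0.
rewrite normrM normfV [`|3 * _|]gtr0_norm; last by rewrite mulr_gt0.
rewrite ler_pdivrMr ?mulr_gt0// mulrCA mulfVK ?lt0r_neq0//; lra.
Qed.

End QNumbers.

(** * Existence of a solution of D = 1 *)

(** Intermediate values for the polynomial [p] obtained by clearing denominators: [p(0) = -L], and
    [p(1)] is twice the sum of the [j^2 - j], which is positive once L >= 2. *)
Lemma qdisp_eq1_exists (F : rcfType) (L : nat) : (2 <= L)%N ->
  exists x : F, 0 < x < 1 /\ qdisp L x = 1.
Proof.
move=> L2.
pose q n : {poly F} := \sum_(i < n) 'X^i.
pose p : {poly F} := (1 + 'X) * (\sum_(1 <= j < L.+1) q j ^+ 2)
  - 2%:P * \sum_(1 <= j < L.+1) q j.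
have qE n x : (q n).[x] = qnum x n.
  by rewrite /q horner_sum; apply: eq_bigr => i _; rewrite hornerXn.
have pE x : p.[x] = (1 + x) * qnum_sqsum x L - 2 * qnum_sum x L.
  rewrite /p !hornerE !horner_sum; congr (_ * _ - _ * _).
    by apply: eq_bigr => j _; rewrite horner_exp qE.
  by apply: eq_bigr => j _; rewrite qE.
have q0 n : qnum (0 : F) n.+1 = 1.
  by rewrite /qnum big_ord_recl expr0 big1 ?addr0// => i _; rewrite expr0n.
have q1 n : qnum (1 : F) n = n%:R.
  rewrite /qnum (eq_bigr (fun=> 1)) ?sumr_const ?card_ord// => i _.
  by rewrite expr1n.
have p0 : p.[0] < 0.
  rewrite pE addr0 mul1r subr_lt0 mulr_natl mulr2n.
  have -> : qnum_sqsum (0 : F) L = qnum_sum 0 L.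
    by apply: eq_big_nat => -[//|j] _; rewrite q0 expr1n.
  by rewrite ltrDl qnum_sum_gt0// (ltnW L2).
have p1 : 0 < p.[1].
  rewrite pE -mulrBr pmulr_rgt0// subr_gt0;
  case: L L2 {p pE p0} => [//|[//|L] _].
  rewrite qnum_sqsumS qnum_sumS ler_ltD// ?q1.
    apply: ler_sum_nat => j /andP[j1 _].
    by rewrite q1 -natrX ler_nat -{1}[j]expn1 leq_pexp2l.
  by rewrite -natrX ltr_nat -{1}[L.+2]expn1 ltn_exp2l.
have [|x /andP[x0 x1] /rootP px] := poly_ivt (p := p) ler01.
  by rewrite !ltW.
have x_gt0 : 0 < x.
  rewrite lt_neqAle x0 andbT; apply: contraTneq p0 => x_eq0.
  by rewrite {1}x_eq0 px ltxx.
exists x; split.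
  rewrite x_gt0 lt_neqAle x1 andbT; apply: contraTneq p1 => xE.
  by rewrite -xE px ltxx.
apply/qdisp_eq1; rewrite ?(ltnW L2)//.
by apply/eqP; rewrite -subr_eq0 -pE px.
Qed.

(** * Mean and variance of sums of indicators *)

Section IndicatorSums.
Context d (T : measurableType d) (R : realType) (P : probability T R).

Lemma Lfun1_indic (A : set T) : measurable A -> \1_A \in Lfun P 1.
Proof. by move=> mA; apply/Lfun1_integrable; exact: integrable_indic. Qed.

Lemma expectation_sum_indic (I : Type) (s : seq I) (A : I -> set T) :
  (forall i, measurable (A i)) ->
  ('E_P[(\sum_(i <- s) \1_(A i))%R])%E = (\sum_(i <- s) fine (P (A i)))%:E.
Proof.
move=> mA.
elim: s => [|i s IH]; first by rewrite !big_nil expectation_cst.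
rewrite !big_cons expectationD; last 2 first.
  exact: Lfun1_indic.
  by apply: rpred_sum => j _; exact: Lfun1_indic.
by rewrite IH expectation_indic// EFinD fineK// fin_num_measure.
Qed.

Lemma variance_sum_indic (I : Type) (s : seq I) (A : I -> set T) :
  (forall i, measurable (A i)) ->
  ('V_P[(\sum_(i <- s) \1_(A i))%R])%E =
  (\sum_(i <- s) \sum_(j <- s) fine (P (A i `&` A j))
   - (\sum_(i <- s) fine (P (A i))) ^+ 2)%:E.
Proof.
move=> mA; have L1 : \sum_(i <- s) \1_(A i) \in Lfun P 1.
  by apply: rpred_sum => j _; exact: Lfun1_indic.
(* The square is again a sum of indicators, now over pairs, so it is integrable and its mean is
   known. *)
have XX : (\sum_(i <- s) \1_(A i)) * (\sum_(i <- s) \1_(A i)) =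
    \sum_(p <- [seq (i, j) | i <- s, j <- s]) \1_(A p.1 `&` A p.2) :> (T -> R).
  rewrite big_allpairs mulr_suml; apply: eq_bigr => i _ /=.
  by rewrite mulr_sumr; apply: eq_bigr => j _; rewrite indicI.
have mAA (p : I * I) : measurable (A p.1 `&` A p.2) by exact: measurableI.
rewrite /variance covarianceE//; last first.
  by rewrite XX; apply: rpred_sum => p _; exact: Lfun1_indic.
rewrite XX !expectation_sum_indic//.
by rewrite big_allpairs EFinB EFinM.
Qed.

End IndicatorSums.

(** * One- and two-time probabilities of the chain, and its dispersion *)

Section TwoStateChain.
Context d (T : measurableType d) (R : realType) (P : probability T R).
Context (mu : R) (sigma : nat -> {RV P >-> bool}).
Context (chain : markov_chain (state_kernel mu) false sigma).

(** Unlike the events in [markov_chain], a history may leave some times free, by [C i = setT]. *)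
Definition history (n : nat) (C : nat -> set bool) : set T :=
  [set w | forall i, (i <= n)%N -> C i (sigma i w)].

Lemma measurable_history n C : measurable (history n C).
Proof.
have -> : history n C =
    \bigcap_(i in [set i | (i <= n)%N]) (sigma i @^-1` C i) by [].
apply: bigcap_measurable; first by exists 0%N.
by move=> k _; exact: measurable_funPTI.
Qed.

Lemma measurable_state k b : measurable (sigma k @^-1` [set b]).
Proof. exact: measurable_funPTI. Qed.

Lemma probability_split_state k A : measurable A ->
  fine (P A) = fine (P (A `&` sigma k @^-1` [set true])) +
               fine (P (A `&` sigma k @^-1` [set false])).
Proof.
move=> mA; have mAS b : measurable (A `&` sigma k @^-1` [set b]).
  by apply: measurableI => //; exact: measurable_state.
rewrite -fineD ?fin_num_measure// -measureU//; last first.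
  by apply/seteqP; split => // w [[_ /= ->] [_ ]].
rewrite -setIUr -preimage_setU (_ : _ `|` _ = setT) ?preimage_setT ?setIT//.
by apply/seteqP; split => // -[] _; [left|right].
Qed.

Lemma history_restrict n k C b : (k <= n)%N ->
  history n C `&` sigma k @^-1` [set b] =
  history n (fun i => if i == k then C i `&` [set b] else C i).
Proof.
move=> kn; apply/seteqP; split => w /=.
  by move=> [h wb] i im; case: eqP => [->|_]; [split; [exact: h|]|exact: h].
move=> h; split=> [i im|]; first by have := h i im; case: eqP => _ // [].
by have := h k kn; rewrite eqxx => -[].
Qed.

(** Induction on the number [k] of initial times that need not be fixed: splitting on the state at
    time [k] fixes one more time. *)
Lemma markov_history n k C (s : nat -> bool) b : (k <= n)%N ->
  (forall i, (k <= i <= n)%N -> C i `<=` [set s i]) ->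
  fine (P (history n C `&` sigma n.+1 @^-1` [set b])) =
  fine (P (history n C)) * state_kernel mu (s n) b.
Proof.
elim: k C s => [|k IH] C s kn Cs.
  (* With all times fixed, either some [C i] is empty and both sides vanish, or the history is one
     path and the chain hypothesis applies to that path extended by [b]. *)
  have [Call|/existsNP[i /not_implyP[im Ci]]] :=
      pselect (forall i, (i <= n)%N -> C i (s i)); last first.
    suff -> : history n C = set0 by rewrite set0I measure0 mul0r.
    apply/seteqP; split => // w h.
    by have := h i im => /[dup] /(Cs _ im) /= ->.
  pose s' i := if i == n.+1 then b else s i.
  have s'E i : (i <= n)%N -> s' i = s i by move=> im; rewrite /s' ltn_eqF.
  have CE : history n C = [set w | forall i, (i <= n)%N -> sigma i w = s' i].
    apply/seteqP; split => w h i im; first by rewrite s'E//; exact/Cs/h.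
    by rewrite h// s'E//; exact: Call.
  rewrite -(s'E n)// (_ : b = s' n.+1); last by rewrite /s' eqxx.
  rewrite -[X in _ * X]/(fine (state_kernel mu (s' n) (s' n.+1))%:E).
  rewrite -fineM ?fin_num_measure//; last exact: measurable_history.
  rewrite CE -chain.2; congr (fine (P _)); apply/seteqP; split => w /=.
    by move=> [h hn] i; rewrite leq_eqVlt ltnS => /predU1P[->//|]; exact: h.
  by move=> h; split => [i im|]; apply: h => //; exact: leqW.
rewrite (probability_split_state k); last first.
  by apply: measurableI; [exact: measurable_history|exact: measurable_state].
rewrite (probability_split_state k (history n C)); last first.
  exact: measurable_history.
rewrite mulrDl !(setIAC _ (_ @^-1` [set b])) !(history_restrict _ k) 1?ltnW//.
have step c :
    fine (P (history n (fun i => if i == k then C i `&` [set c] else C i)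
      `&` sigma n.+1 @^-1` [set b])) =
    fine (P (history n (fun i => if i == k then C i `&` [set c] else C i))) *
    state_kernel mu (s n) b.
  have -> : s n = if n == k then c else s n by rewrite gtn_eqF.
  apply: (IH _ (fun i => if i == k then c else s i)); first exact: ltnW.
  move=> i /andP[ki im]; case: eqP => [_ x []//|/eqP ik].
  by apply: Cs; rewrite im ltn_neqAle eq_sym ik ki.
by rewrite !step.
Qed.

(** Splitting on the state at time [n], where the probabilities of moving to state 1 from 1 and from
    0 differ by [mu]. This recursion yields both the one- and the two-time probabilities. *)
Lemma markov_history_true n C :
  fine (P (history n C `&` sigma n.+1 @^-1` [set true])) =
  mu * fine (P (history n C `&` sigma n @^-1` [set true])) +
  (1 - mu) / 2 * fine (P (history n C)).
Proof.
have mh := measurable_history n C.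
have mhn : measurable (history n C `&` sigma n.+1 @^-1` [set true]).
  by apply: measurableI => //; exact: measurable_state.
rewrite (probability_split_state n)// [in RHS](probability_split_state n _ mh).
rewrite !(setIAC _ (sigma n.+1 @^-1` _)) !(history_restrict _ n)//.
have step c :
    fine (P (history n (fun i => if i == n then C i `&` [set c] else C i)
      `&` sigma n.+1 @^-1` [set true])) =
    fine (P (history n (fun i => if i == n then C i `&` [set c] else C i))) *
    state_kernel mu c true.
  apply: (markov_history _ n _ (fun=> c)) => // i; rewrite -eqn_leq => /eqP <-.
  by rewrite eqxx => x [].
by rewrite !step /state_kernel /=; field.
Qed.

Lemma probability_state_true j :
  fine (P (sigma j @^-1` [set true])) = (1 - mu ^+ j) / 2.
Proof.
elim: j => [|j IH].
  have := probability_split_state 0 setT measurableT.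
  rewrite !setTI probability_setT.
  have -> : sigma 0%N @^-1` [set false] = [set w | sigma 0%N w = false] by [].
  by rewrite chain.1 /= => ?; rewrite expr0; lra.
have /= := markov_history_true j (fun=> setT).
have -> : history j (fun=> setT) = setT by apply/seteqP; split.
by rewrite !setTI probability_setT IH => ->; rewrite exprS /=; field.
Qed.

Lemma probability_state_pair i j : (i <= j)%N ->
  fine (P (sigma i @^-1` [set true] `&` sigma j @^-1` [set true])) =
  (1 - mu ^+ i) / 2 * ((1 + mu ^+ (j - i)) / 2).
Proof.
move=> /subnK <-; rewrite addnK; elim: (j - i)%N => [|k IH].
  by rewrite add0n setIid probability_state_true expr0; field.
(* The recursion is applied to the history constrained at time [i] only. *)
have := markov_history_true (k + i)
  (fun m => if m == i then [set true] else setT).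
have -> : history (k + i) (fun m => if m == i then [set true] else setT) =
    sigma i @^-1` [set true].
  apply/seteqP; split => w /=.
    by move=> /(_ i (leq_addl _ _)); rewrite eqxx.
  by move=> wi m _; case: eqP => [->|].
by rewrite addSn => ->; rewrite IH probability_state_true exprS; field.
Qed.

Lemma sum_probability_state L :
  \sum_(1 <= j < L.+1) fine (P (sigma j @^-1` [set true])) =
  (1 - mu) / 2 * qnum_sum mu L.
Proof.
rewrite /qnum_sum mulr_sumr; apply: eq_bigr => j _.
by rewrite probability_state_true -qnum_mul1B; field.
Qed.

(* Pairing [i] with [L.+1 - i] makes the correlation terms cancel. *)
Lemma sum_probability_state_last L :
  \sum_(1 <= i < L.+1)
    fine (P (sigma i @^-1` [set true] `&` sigma L.+1 @^-1` [set true])) =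
  L%:R * ((1 - mu ^+ L.+1) / 4).
Proof.
pose f i := (1 - mu ^+ i) * (1 + mu ^+ (L.+1 - i)) / 4.
rewrite (eq_big_nat _ _ (F2 := f)); last first.
  move=> i /andP[_ iL]; rewrite probability_state_pair; last exact: ltnW.
  by rewrite /f; field.
have -> : \sum_(1 <= i < L.+1) f i =
    (\sum_(1 <= i < L.+1) f i + \sum_(1 <= i < L.+1) f i) / 2 by field.
rewrite {2}big_nat_rev -big_split.
rewrite (eq_big_nat _ _ (F2 := fun=> (1 - mu ^+ L.+1) / 2)).
  by rewrite sumr_const_nat subn1 -mulr_natl /=; field.
move=> i /andP[_ iL] /=; rewrite /f add1n subSS.
have iL' : (i <= L.+1)%N by exact: ltnW.
by rewrite subKn// -{3}(subnKC iL') exprD; field.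
Qed.

Lemma sum_covariance_state L :
  \sum_(1 <= i < L.+1) \sum_(1 <= j < L.+1)
    fine (P (sigma i @^-1` [set true] `&` sigma j @^-1` [set true]))
  - (\sum_(1 <= j < L.+1) fine (P (sigma j @^-1` [set true]))) ^+ 2 =
  (1 - mu) * (1 + mu) / 4 * qnum_sqsum mu L.
Proof.
rewrite sum_probability_state; elim: L => [|L /(canRL (subrK _)) IH].
  by rewrite /qnum_sum /qnum_sqsum !big_geq//; ring.
rewrite big_nat_recr//=; under eq_bigr do rewrite big_nat_recr//=.
rewrite big_split /= IH [X in _ + X - _]big_nat_recr//= setIid.
rewrite probability_state_true.
under [X in _ + (X + _) - _]eq_bigr do rewrite setIC.
rewrite !sum_probability_state_last qnum_sumS qnum_sqsumS.
(* L, [b_(L+1)] and [mu^(L+1)] are expressed through [b_L] and the sum of the [b_j], which makes the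
   induction step a polynomial identity. *)
have LE : L%:R = qnum_sum mu L * (1 - mu) + mu * qnum mu L.
  by rewrite qnum_sum_mul1B_rec subrK.
have bE : qnum mu L.+1 = 1 + mu * qnum mu L.
  by rewrite qnumS -[mu ^+ L](subKr 1) -qnum_mul1B; ring.
have xE : mu ^+ L.+1 = 1 - qnum mu L.+1 * (1 - mu).
  by rewrite qnum_mul1B subKr.
by rewrite xE bE LE; field.
Qed.

Lemma dispersion_qdisp L : 0 < mu < 1 -> (0 < L)%N ->
  dispersion sigma L = qdisp L mu.
Proof.
move=> /andP[mu0 mu1] L0.
have cE : state_count sigma L =
    \sum_(1 <= j < L.+1) \1_(sigma j @^-1` [set true]).
  apply/funext => w; rewrite /state_count fct_sumE; apply: eq_bigr => j _.
  by rewrite indicE; case E : (sigma j w);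
    [rewrite mem_set|rewrite memNset //= E].
rewrite /dispersion cE variance_sum_indic; last first.
  by move=> j; exact: measurable_state.
rewrite expectation_sum_indic /=; last by move=> j; exact: measurable_state.
rewrite sum_covariance_state sum_probability_state /qdisp.
(* Variance and mean share the factor [1 - mu], which cancels. *)
have B0 := lt0r_neq0 (qnum_sum_gt0 mu L (ltW mu0) L0).
have mu1' : 1 - mu != 0 by rewrite subr_eq0 gt_eqF.
by field; rewrite ?B0 ?mu1'.
Qed.

End TwoStateChain.

Theorem theorem7p4 (R : realType)
    (d : R -> measure_display) (T : forall mu : R, measurableType (d mu))
    (P : forall mu : R, probability (T mu) R)
    (sigma : forall mu : R, nat -> {RV (P mu) >-> bool})
    (Hsigma : forall mu : R, 0 < mu < 1 ->
       markov_chain (state_kernel mu) false (sigma mu)) :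
  let D (L : nat) (mu : R) : R := dispersion (sigma mu) L in
  [/\ (forall mu : R, 0 < mu < 1 ->
         forall L L' : nat, (1 <= L)%N -> (L < L')%N -> D L mu < D L' mu),
      (forall L : nat, (1 <= L)%N ->
         forall mu mu' : R, 0 < mu < 1 -> 0 < mu' < 1 -> mu < mu' ->
           D L mu < D L mu')
    & (forall L : nat, (2 <= L)%N ->
         exists! mu : R, 0 < mu < 1 /\ D L mu = 1) /\
      (forall mustar : nat -> R,
         (forall L : nat, (2 <= L)%N ->
            0 < mustar L < 1 /\ D L (mustar L) = 1) ->
         (forall L L' : nat, (2 <= L)%N -> (L < L')%N ->
            mustar L' < mustar L) /\
         (fun L : nat => mustar L - (1 / 3 + 1 / (6 * L%:R)) : R)
           =O_\oo (fun L : nat => 1 / L%:R ^+ 2 : R))].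
Proof.
move=> D; have DE L mu : 0 < mu < 1 -> (0 < L)%N -> D L mu = qdisp L mu.
  by move=> mu01; exact: dispersion_qdisp (Hsigma mu mu01) L mu01.
split; first 2 last.
- split=> [L L2|mustar Hstar].
    have [x [x01 x1]] := qdisp_eq1_exists R L L2.
    exists x; split=> [|y [y01 Dy]]; first by rewrite DE// ltnW.
    move: Dy; rewrite DE ?(ltnW L2)// => y1.
    have [/andP[x0 _] /andP[y0 _]] := (x01, y01).
    have [xy|yx|//] := ltgtP x y.
    - by have := qdisp_lt L x y (ltnW L2) x0 xy; rewrite x1 y1 ltxx.
    - by have := qdisp_lt L y x (ltnW L2) y0 yx; rewrite x1 y1 ltxx.
  have star L : (2 <= L)%N -> 0 < mustar L /\ qdisp L (mustar L) = 1.
    move=> L2; have [m01 Dm] := Hstar L L2; split; first by case/andP: m01.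
    by rewrite -DE// ltnW.
  split=> [L L' L2 LL'|].
    have [m0 m1] := star L L2.
    have [m'0 m'1] := star L' (leq_trans L2 (ltnW LL')).
    (* If [mustar L <= mustar L'], then D(L', [mustar L]) <= 1 = D(L, [mustar L]), against growth in
       L. *)
    rewrite ltNge; apply/negP; rewrite le_eqVlt => mm'.
    have : qdisp L' (mustar L) <= qdisp L' (mustar L').
      case/predU1P: mm' => [->//|mm'].
      by rewrite ltW// qdisp_lt// (leq_trans _ LL').
    rewrite m'1 leNgt -[ltLHS]m1 qdisp_ltn// inE ltnW//.
    exact: ltn_trans LL'.
  (* The constant 6 is the one of [qdisp_eq1_asymp]. *)
  apply/eqO_exP; exists 6 => //; near=> L.
  have L2 : (2 <= L)%N by near: L; exact: nbhs_infty_ge.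
  have [m0 m1] := star L L2.
  rewrite [X in _ <= _ * X]ger0_norm ?divr_ge0 ?exprn_ge0//.
  rewrite [X in _ <= _ * X]mul1r.
  exact: qdisp_eq1_asymp.
- move=> mu mu01 L L' L1 LL'; have L'1 := leq_trans L1 (ltnW LL').
  by rewrite !DE// qdisp_ltn//; case/andP: mu01.
- move=> L L1 mu mu' mu01 mu'01 mumu'.
  by rewrite !DE// qdisp_lt//; case/andP: mu01.
Unshelve. all: by end_near.
Qed.
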